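(* Let $K,H$ be finite dimensional Hilbert spaces and let $\phi:B(K)\to B(H)$ be a self-adjoint linear map (i.e. $\phi(a)$ is self-adjoint whenever $a$ is self-adjoint) such that $-\phi$ is not completely positive. Write $C_\phi = C_\phi^+ - C_\phi^-$ for the decomposition of the self-adjoint Choi matrix $C_\phi$ into positive operators with orthogonal supports. Then: (i) There exists a completely positive map $\phi_{cp}:B(K)\to B(H)$ such that $\|C_\phi^+\|^{-1}\phi = \mathrm{Tr} - \phi_{cp}$, where $\mathrm{Tr}$ denotes the map $x\mapsto \mathrm{Tr}(x)1_H$. (ii) If $\mathcal{C}$ is a mapping cone on $B(H)$ containing $CP$, then $\phi$ is $\mathcal{C}$-positive if and only if $$\|\phi_{cp}\|_{\mathcal{C}} = \sup \rho(C_{\phi_{cp}}) \le 1,$$ where the supremum is taken over all states $\rho$ on $B(K\otimes H)$ whose density operator is $C_\psi$ for some $\psi\in \mathcal{P}_{\mathcal{C}}^o$.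
   Context: $K,H$ are finite dimensional Hilbert spaces; $B(K\otimes H)$ is identified with $B(K)\otimes B(H)$. Fix matrix units $(e_{ij})$ for $B(K)$ (from an orthonormal basis), and let $t$ denote the transpose on $B(H)$ with respect to a fixed orthonormal basis. The Choi matrix of a linear map $\phi:B(K)\to B(H)$ is $C_\phi=\sum_{i,j} e_{ij}\otimes\phi(e_{ij})\in B(K\otimes H)$; $\phi$ is completely positive iff $C_\phi\ge 0$. To $\phi$ associate the linear functional $\tilde\phi$ on $B(K\otimes H)$ with $\tilde\phi(a\otimes b)=\mathrm{Tr}(\phi(a)b^t)$. Let $P(H)$ be the positive linear maps $B(H)\to B(H)$ and $CP$ the completely positive ones. A mapping cone is a closed cone $\mathcal{C}\subset P(H)$ with $\alpha\circ\phi\circ\beta\in\mathcal{C}$ for all $\phi\in\mathcal{C}$, $\alpha,\beta\in CP$. Set $P(B(K),\mathcal{C})=\{a\in B(K\otimes H): (\iota\otimes\alpha)(a)\ge 0\ \forall\alpha\in\mathcal{C}\}$ ($\iota$ the identity on $B(K)$). A map $\phi:B(K)\to B(H)$ is $\mathcal{C}$-positive if $\tilde\phi(a)\ge 0$ for all $a\in P(B(K),\mathcal{C})$; $\mathcal{P}_{\mathcal{C}}$ denotes the cone of $\mathcal{C}$-positive maps, and its dual cone is $\mathcal{P}_{\mathcal{C}}^o=\{\psi:B(K)\to B(H)\text{ linear}: \mathrm{Tr}(C_\psi C_\chi)\ge 0\ \forall\chi\in\mathcal{P}_{\mathcal{C}}\}$. The norm $\|\cdot\|_{\mathcal{C}}$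 on linear maps $B(K)\to B(H)$ is $\|\phi\|_{\mathcal{C}}=\sup\{|\mathrm{Tr}(C_\phi C_\psi)|:\psi\in\mathcal{P}_{\mathcal{C}}^o,\ \mathrm{Tr}(C_\psi)=1\}$. A state $\rho$ has density operator $D$ if $\rho(x)=\mathrm{Tr}(Dx)$. *)

(* Defs.v *)
From HB Require Import structures.
From mathcomp Require Import all_boot all_order all_algebra.
From mathcomp Require Import all_classical all_reals all_analysis.
From mathcomp Require Import complex mxtens.

Unset Strict Implicit.
Unset Printing Implicit Defensive.

Import Order.TTheory GRing.Theory Num.Theory.
Import numFieldNormedType.Exports.
Local Open Scope ring_scope.
Local Open Scope classical_set_scope.

(* Finite-dimensional Hilbert spaces K = C^m, H = C^n (with fixed orthonormal
   bases), C = R[i].  B(K) = 'M_m, B(H) = 'M_n, B(K (x) H) = 'M_(m*n), where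
   the index of K (x) H is the pair (i,a) encoded by mxtens_index, and
   a (x) b is the Kronecker product tensmx a b. *)

Section QuantumDefs.
Context {R : realType}.
Local Notation C := (R[i]).

Definition adjmx {p q : nat} (A : 'M[C]_(p, q)) : 'M[C]_(q, p) :=
  (map_mx (@conjc R) A)^T.

Definition hermitian {k : nat} (A : 'M[C]_k) : Prop := adjmx A = A.

Definition psd {k : nat} (A : 'M[C]_k) : Prop :=
  forall v : 'cV[C]_k, 0 <= (adjmx v *m A *m v) 0 0.

Definition vnorm {k : nat} (v : 'cV[C]_k) : R :=
  Num.sqrt (\sum_(i < k) ComplexField.Normc.normc (v i 0) ^+ 2).

Definition opnorm {k : nat} (A : 'M[C]_k) : R :=
  sup [set r : R | exists v : 'cV[C]_k, vnorm v <= 1 /\ r = vnorm (A *m v)].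

(* the operators A, B have orthogonal supports (ranges) : <A u, B v> = 0 *)
Definition orth_supports {k : nat} (A B : 'M[C]_k) : Prop :=
  adjmx A *m B = 0.

Definition blk {k p : nat} (X : 'M[C]_(k * p)) (i i' : 'I_k) : 'M[C]_p :=
  \matrix_(a, b) X (mxtens_index (i, a)) (mxtens_index (i', b)).

(* iota_k (x) f : B(C^k) (x) B(C^p) -> B(C^k) (x) B(C^q) *)
Definition ampl (k : nat) {p q : nat} (f : 'M[C]_p -> 'M[C]_q)
  (X : 'M[C]_(k * p)) : 'M[C]_(k * q) :=
  \matrix_(s, t) f (blk X (mxtens_unindex s).1 (mxtens_unindex t).1)
                    (mxtens_unindex s).2 (mxtens_unindex t).2.


Definition positive_map {p q : nat} (f : 'M[C]_p -> 'M[C]_q) : Prop :=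
  forall A, psd A -> psd (f A).

Definition cpmap {p q : nat} (f : 'M[C]_p -> 'M[C]_q) : Prop :=
  linear f /\ forall k : nat, positive_map (ampl k f).

Definition selfadjoint_map {p q : nat} (f : 'M[C]_p -> 'M[C]_q) : Prop :=
  forall a, hermitian a -> hermitian (f a).

Definition choi {p q : nat} (f : 'M[C]_p -> 'M[C]_q) : 'M[C]_(p * q) :=
  \sum_(i < p) \sum_(j < p) tensmx (delta_mx i j) (f (delta_mx i j)).

Definition trmap {p q : nat} (x : 'M[C]_p) : 'M[C]_q := (\tr x) *: 1%:M.

(* the functional ~f on B(K (x) H): the linear extension of
   a (x) b |-> Tr(f(a) b^t), i.e. X |-> sum_{ij} Tr(f(e_ij) X_ij^t) *)
Definition tildef {p q : nat} (f : 'M[C]_p -> 'M[C]_q) (X : 'M[C]_(p * q)) : C :=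
  \sum_(i < p) \sum_(j < p) \tr (f (delta_mx i j) *m (blk X i j)^T).

Definition PH {q : nat} (f : 'M[C]_q -> 'M[C]_q) : Prop :=
  linear f /\ positive_map f.

Definition mapping_cone {q : nat} (Cc : set ('M[C]_q -> 'M[C]_q)) : Prop :=
  [/\ (forall f, Cc f -> PH f),
      (forall f g, Cc f -> Cc g -> Cc (fun x => f x + g x)),
      (forall (a : R) f, 0 <= a -> Cc f -> Cc (fun x => (a%:C)%C *: f x)),
      (forall (fs : nat -> 'M[C]_q -> 'M[C]_q) (g : 'M[C]_q -> 'M[C]_q),
          (forall k, Cc (fs k)) ->
          (forall x i j, (fun k => complex.Re (fs k x i j)) @ \oo --> complex.Re (g x i j)) ->
          (forall x i j, (fun k => complex.Im (fs k x i j)) @ \oo --> complex.Im (g x i j)) ->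
          Cc g) &
      (forall f a b, Cc f -> cpmap a -> cpmap b -> Cc (a \o f \o b))].

Definition PBK (p : nat) {q : nat} (Cc : set ('M[C]_q -> 'M[C]_q)) :
  set 'M[C]_(p * q) :=
  [set X | forall alpha, Cc alpha -> psd (ampl p alpha X)].


Definition Cpositive {p q : nat} (Cc : set ('M[C]_q -> 'M[C]_q))
  (f : 'M[C]_p -> 'M[C]_q) : Prop :=
  forall X, PBK p Cc X -> 0 <= tildef f X.

Definition PC (p : nat) {q : nat} (Cc : set ('M[C]_q -> 'M[C]_q)) :
  set ('M[C]_p -> 'M[C]_q) :=
  [set f | linear f /\ Cpositive Cc f].

Definition PCdual (p : nat) {q : nat} (Cc : set ('M[C]_q -> 'M[C]_q)) :
  set ('M[C]_p -> 'M[C]_q) :=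
  [set psi | linear psi /\
     forall chi, PC p Cc chi -> 0 <= \tr (choi psi *m choi chi)].


Definition Cnorm {p q : nat} (Cc : set ('M[C]_q -> 'M[C]_q))
  (f : 'M[C]_p -> 'M[C]_q) : R :=
  sup [set r : R | exists psi, PCdual p Cc psi /\ \tr (choi psi) = 1 /\
                     r = ComplexField.Normc.normc (\tr (choi f *m choi psi))].

Definition state {k : nat} (rho : 'M[C]_k -> C) : Prop :=
  [/\ linear rho, (forall A, psd A -> 0 <= rho A) & rho 1%:M = 1].

Definition has_density {k : nat} (rho : 'M[C]_k -> C) (D : 'M[C]_k) : Prop :=
  forall x, rho x = \tr (D *m x).

End QuantumDefs.

(* Main.v *)
(* With N the operator norm of Cp, the Choi matrix of Tr - N^-1 phi is
   N^-1 (N 1 - Cp) + N^-1 Cm >= 0, so this map is completely positive.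
   For (ii), ~f(X) = Tr(C_f X^T) exhibits P_C as a dual cone, so P_C equals its
   bidual without any separation theorem: phi is C-positive iff
   Tr(C_psi C_phi) >= 0 for all psi in P_C^o, i.e. iff
   Tr(C_psi C_phicp) <= Tr(C_psi) for all these psi.  As C contains the
   identity, each such C_psi is positive semidefinite, so the ones of trace 1
   are density operators. *)
Require Import Defs.
From HB Require Import structures.
From mathcomp Require Import all_boot all_order all_algebra.
From mathcomp Require Import all_classical all_reals all_analysis.
From mathcomp Require Import complex mxtens ring.

Set Implicit Arguments.
Unset Strict Implicit.
Unset Printing Implicit Defensive.

Import Order.TTheory GRing.Theory Num.Theory.
Import numFieldNormedType.Exports.
Local Open Scope ring_scope.
Local Open Scope classical_set_scope.

(** * Adjoints and positive semidefinite matrices *)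

Lemma adjmxE (R : realType) (p q : nat) (A : 'M[R[i]]_(p, q)) i j :
  adjmx A i j = conjc (A j i).
Proof. by rewrite !mxE. Qed.

Lemma adjmxK (R : realType) (p q : nat) (A : 'M[R[i]]_(p, q)) :
  adjmx (adjmx A) = A.
Proof. by apply/matrixP=> i j; rewrite !adjmxE conjcK. Qed.

Lemma adjmxM (R : realType) (p q r : nat)
  (A : 'M[R[i]]_(p, q)) (B : 'M[R[i]]_(q, r)) :
  adjmx (A *m B) = adjmx B *m adjmx A.
Proof. by rewrite /adjmx map_mxM trmx_mul. Qed.

Lemma adjmxD (R : realType) (p q : nat) (A B : 'M[R[i]]_(p, q)) :
  adjmx (A + B) = adjmx A + adjmx B.
Proof. by apply/matrixP=> i j; rewrite !(adjmxE, mxE) rmorphD. Qed.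

Lemma adjmxN (R : realType) (p q : nat) (A : 'M[R[i]]_(p, q)) :
  adjmx (- A) = - adjmx A.
Proof. by apply/matrixP=> i j; rewrite !(adjmxE, mxE) rmorphN. Qed.

Lemma adjmxZ (R : realType) (p q : nat) (c : R[i]) (A : 'M[R[i]]_(p, q)) :
  adjmx (c *: A) = conjc c *: adjmx A.
Proof. by apply/matrixP=> i j; rewrite !(adjmxE, mxE) rmorphM. Qed.

Lemma adjmx_delta (R : realType) (p : nat) (i : 'I_p) :
  adjmx (delta_mx i 0 : 'cV[R[i]]_p) = delta_mx 0 i.
Proof.
by apply/matrixP=> j k; rewrite adjmxE !mxE andbC; case: andb;
  rewrite ?rmorph1 ?rmorph0.
Qed.

Lemma sesq_delta (R : realType) (p : nat) (A : 'M[R[i]]_p) i j :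
  (adjmx (delta_mx i 0 : 'cV[R[i]]_p) *m A *m (delta_mx j 0 : 'cV_p)) 0 0 = A i j.
Proof. by rewrite adjmx_delta -rowE -colE !mxE. Qed.

(** Polarization over the complex numbers: the diagonal vanishes at the basis vectors, and the
    vectors e_i + c e_j with c = 1 and c = 'i give B_ij = - B_ji and B_ij = B_ji. *)
Lemma quad_form_eq0 (R : realType) (p : nat) (B : 'M[R[i]]_p) :
  (forall v : 'cV_p, (adjmx v *m B *m v) 0 0 = 0) -> B = 0.
Proof.
move=> B0; have Bd i : B i i = 0 by rewrite -(sesq_delta B).
have addE (X Y : 'M[R[i]]_1) : (X + Y) 0 0 = X 0 0 + Y 0 0 by rewrite mxE.
have scaleE (c : R[i]) (X : 'M[R[i]]_1) : (c *: X) 0 0 = c * X 0 0.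
  by rewrite mxE.
have Bc c i j : B i j * c + conjc c * B j i = 0.
  have := B0 ((delta_mx i 0 : 'cV_p) + c *: delta_mx j 0).
  rewrite adjmxD adjmxZ !(mulmxDl, mulmxDr) -!scalemxAl -!scalemxAr.
  rewrite !addE !scaleE !sesq_delta !Bd.
  by rewrite !mulr0 addr0 add0r addrC mulrC.
apply/matrixP=> i j; rewrite mxE.
have /eqP := Bc 1 i j; rewrite rmorph1 mulr1 mul1r addr_eq0 => /eqP e1.
have := Bc 'i%C i j.
have -> : conjc 'i%C = - 'i%C :> R[i].
  by apply/eqP; rewrite eq_complex /= oppr0 !eqxx.
rewrite e1 mulrC mulrN mulNr -opprD -mulr2n => /eqP.
rewrite oppr_eq0 mulrn_eq0 /= mulf_eq0.
move=> /orP[/eqP[]|/eqP->]; last by rewrite oppr0.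
by move=> /eqP; rewrite oner_eq0.
Qed.

(** In the order of [R[i]], [0 <= z] forces z to be real, so the quadratic form of A equals its own
    conjugate, which is the form of A^*. *)
Lemma psd_hermitian (R : realType) (p : nat) (A : 'M[R[i]]_p) :
  psd A -> adjmx A = A.
Proof.
move=> Apsd; apply/eqP; rewrite -subr_eq0; apply/eqP/quad_form_eq0 => v.
rewrite mulmxBr mulmxBl mxE [X in _ + X]mxE.
apply/eqP; rewrite subr_eq0; apply/eqP.
have -> : adjmx v *m adjmx A *m v = adjmx (adjmx v *m A *m v).
  by rewrite !adjmxM adjmxK mulmxA.
rewrite adjmxE.
have := Apsd v; case: ((_ *m v) 0 0) => a b /ger0_Im /= ->.
by rewrite oppr0.
Qed.

Lemma psd_conj (R : realType) (p q : nat) (A : 'M[R[i]]_p)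
  (V : 'M[R[i]]_(p, q)) : psd A -> psd (adjmx V *m A *m V).
Proof. by move=> Apsd v; have := Apsd (V *m v); rewrite adjmxM !mulmxA. Qed.

Lemma psdD (R : realType) (p : nat) (A B : 'M[R[i]]_p) :
  psd A -> psd B -> psd (A + B).
Proof. by move=> hA hB v; rewrite mulmxDr mulmxDl mxE addr_ge0. Qed.

Lemma psdZ (R : realType) (p : nat) (c : R[i]) (A : 'M[R[i]]_p) :
  0 <= c -> psd A -> psd (c *: A).
Proof. by move=> hc hA v; rewrite -scalemxAr -scalemxAl mxE mulr_ge0. Qed.

Lemma psd_sum (R : realType) (p : nat) (I : finType) (F : I -> 'M[R[i]]_p) :
  (forall i, psd (F i)) -> psd (\sum_i F i).
Proof.
move=> hF v; rewrite mulmx_sumr mulmx_suml summxE.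
by apply: sumr_ge0 => i _; apply: hF.
Qed.

(** By the spectral theorem A = P^* diag(d) P with d nonnegative, so W = P^* diag(sqrt d) works. *)
Lemma psd_factor (R : realType) (p : nat) (A : 'M[R[i]]_p) :
  psd A -> exists W : 'M[R[i]]_p, A = W *m adjmx W.
Proof.
move=> Apsd; pose P : 'M[R[i]]_p := spectralmx A.
pose d : 'rV[R[i]]_p := spectral_diag A.
have Pu := spectral_unitarymx A.
have Pi : invmx P = adjmx P.
  by rewrite invmx_unitary //; apply/matrixP=> i j; rewrite adjmxE !mxE.
have AE : A = invmx P *m diag_mx d *m P.
  apply/orthomx_spectralP/normalmxP.
  suff -> : map_mx Num.conj A^T = A by [].
  by rewrite -[RHS]psd_hermitian //; apply/matrixP=> i j; rewrite adjmxE !mxE.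
have d_ge0 i : 0 <= d 0 i.
  (* P A P^* is the diagonal matrix of d, and conjugation preserves positivity; its (i, i) entry is
     the value of its form at e_i. *)
  have := @psd_conj _ _ _ _ (adjmx P) Apsd (delta_mx i 0).
  rewrite sesq_delta adjmxK {1}AE Pi !mulmxA.
  rewrite -Pi mulmxV ?spectral_unit // mul1mx -mulmxA mulmxV ?spectral_unit //.
  by rewrite mulmx1 mxE eqxx.
clearbody P d.
suff [S SE] : exists S : 'M[R[i]]_p, diag_mx d = S *m adjmx S.
  exists (adjmx P *m S); rewrite (adjmxM (adjmx P)) (adjmxK P) AE Pi SE.
  by rewrite [RHS]mulmxA (mulmxA (adjmx P) S).
exists (diag_mx (\row_i sqrtC (d 0 i))).
apply/matrixP=> i j; rewrite mul_diag_mx [RHS]mxE adjmxE !mxE eq_sym.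
case: eqVneq => [->|_]; rewrite ?mulr0n ?mulr1n ?rmorph0 ?mulr0 //.
have /ger0_real/CrealP : 0 <= sqrtC (d 0 i) by rewrite sqrtC_ge0.
by move=> /= E; rewrite [conjc _]E -expr2 sqrtCK.
Qed.

(** With A = W W^*, cyclicity turns the trace into Tr(W^* B W), whose diagonal entries are values of
    a nonnegative form. *)
Lemma mxtrace_psdM_ge0 (R : realType) (p : nat) (A B : 'M[R[i]]_p) :
  psd A -> psd B -> 0 <= \tr (A *m B).
Proof.
move=> /psd_factor[W ->] Bpsd; rewrite -mulmxA mxtrace_mulC.
rewrite sumr_ge0 // => i _; have := @psd_conj _ _ _ _ W Bpsd (delta_mx i 0).
by rewrite sesq_delta.
Qed.

(** * The Choi correspondence *)

Lemma sum_mxtens (R : realType) (p q : nat) (F : 'I_(p * q) -> R[i]) :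
  \sum_k F k = \sum_i \sum_a F (mxtens_index (i, a)).
Proof.
rewrite pair_bigA /= (reindex (@mxtens_index p q)) /=.
  by apply: eq_bigr => -[].
by exists (@mxtens_unindex p q) => ? _; rewrite ?mxtens_indexK ?mxtens_unindexK.
Qed.

Lemma matrix_mxtensP (R : realType) (p q : nat) (A B : 'M[R[i]]_(p * q)) :
  (forall i a j b, A (mxtens_index (i, a)) (mxtens_index (j, b)) =
                   B (mxtens_index (i, a)) (mxtens_index (j, b))) -> A = B.
Proof.
move=> AB; apply/matrixP=> s t.
case: (mxtens_indexP s) => i a; case: (mxtens_indexP t) => j b; exact: AB.
Qed.

Lemma choiE (R : realType) (p q : nat) (f : 'M[R[i]]_p -> 'M[R[i]]_q) i a j b :
  choi f (mxtens_index (i, a)) (mxtens_index (j, b)) = f (delta_mx i j) a b.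
Proof.
rewrite /choi summxE (bigD1 i) //= [X in _ + X]big1 => [|k /negPf ki].
  rewrite addr0 summxE (bigD1 j) //= [X in _ + X]big1 => [|k /negPf kj].
    by rewrite addr0 tensmxE mxE !eqxx mul1r.
  by rewrite tensmxE mxE eqxx eq_sym kj mul0r.
by rewrite summxE big1 // => l _; rewrite tensmxE mxE eq_sym ki mul0r.
Qed.

Lemma choi_inv (R : realType) (p q : nat) (f : 'M[R[i]]_p -> 'M[R[i]]_q) x a b :
  linear f -> f x a b = \sum_i \sum_j x i j *
    choi f (mxtens_index (i, a)) (mxtens_index (j, b)).
Proof.
move=> flin.
pose fL : {linear 'M[R[i]]_p -> 'M[R[i]]_q} :=
  HB.pack f (GRing.isLinear.Build _ _ _ _ f flin).
have fZ c y : f (c *: y) = c *: f y := linearZ_LR fL c y.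
rewrite {1}(matrix_sum_delta x) -[f]/(fL : _ -> _) raddf_sum summxE.
apply: eq_bigr => i _; rewrite raddf_sum summxE; apply: eq_bigr => j _.
by rewrite /fL /= fZ mxE choiE.
Qed.

(** Kraus decomposition: each column of W in C_f = W W^* gives an operator K_l with f(x) the sum of
    the K_l^* x K_l, and every amplification of f is then a sum of conjugations. *)
Lemma choi_psd_cp (R : realType) (p q : nat) (f : 'M[R[i]]_p -> 'M[R[i]]_q) :
  linear f -> psd (choi f) -> cpmap f.
Proof.
move=> flin /psd_factor[W WE]; split=> // k X Xpsd.
(* Column l of W, reshaped to a p by q matrix. The conjugation makes K_l^* e_ij K_l have (a, b)
   entry W_(ia),l times the conjugate of W_(jb),l, the l-th term of C_f. *)
pose K l : 'M[R[i]]_(p, q) := \matrix_(s, a) conjc (W (mxtens_index (s, a)) l).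
pose V l : 'M[R[i]]_(k * p, k * q) := tensmx 1%:M (K l).
suff -> : ampl k f X = \sum_l (adjmx (V l) *m X *m V l).
  by apply: psd_sum => l; apply: psd_conj.
apply: matrix_mxtensP => i a j b.
rewrite mxE !mxtens_indexK /= choi_inv // summxE.
have -> : \sum_l (adjmx (V l) *m X *m V l)
                 (mxtens_index (i, a)) (mxtens_index (j, b))
    = \sum_l \sum_t (\sum_s W (mxtens_index (s, a)) l *
                            X (mxtens_index (i, s)) (mxtens_index (j, t))) *
                    conjc (W (mxtens_index (t, b)) l).
  apply: eq_bigr => l _; rewrite mxE sum_mxtens (bigD1 j) //=.
  rewrite [X in _ + X]big1 => [|j' /negPf jj']; last first.
    by rewrite big1 // => t _; rewrite tensmxE !mxE jj' mul0r mulr0.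
  rewrite addr0; apply: eq_bigr => t _; rewrite tensmxE !mxE eqxx mul1r.
  congr (_ * _); rewrite sum_mxtens (bigD1 i) //=.
  rewrite [X in _ + X]big1 => [|i' /negPf ii']; last first.
    rewrite big1 // => s _.
    by rewrite adjmxE tensmxE !mxE ii' mul0r rmorph0 mul0r.
  rewrite addr0; apply: eq_bigr => s _.
  by rewrite adjmxE tensmxE !mxE eqxx mul1r conjcK.
rewrite exchange_big /= [RHS]exchange_big /=; apply: eq_bigr => t _.
rewrite WE.
under eq_bigr => s _ do rewrite !mxE mulr_sumr.
rewrite exchange_big /=; apply: eq_bigr => l _; rewrite mulr_suml.
by apply: eq_bigr => s _; rewrite adjmxE mulrA [X _ _ * _]mulrC.
Qed.

(** The inverse of [choi]; it turns an arbitrary matrix into a linear map, so that cones of maps can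
    be handled as cones of matrices. *)
Definition unchoi (R : realType) (p q : nat) (D : 'M[R[i]]_(p * q))
    (x : 'M[R[i]]_p) : 'M[R[i]]_q :=
  \matrix_(a, b) \sum_i \sum_j
    x i j * D (mxtens_index (i, a)) (mxtens_index (j, b)).

Lemma unchoi_linear (R : realType) (p q : nat) (D : 'M[R[i]]_(p * q)) :
  linear (unchoi D).
Proof.
move=> c x y; apply/matrixP=> a b; rewrite !mxE mulr_sumr -big_split /=.
apply: eq_bigr => i _; rewrite mulr_sumr -big_split; apply: eq_bigr => j _.
by rewrite !mxE mulrDl mulrA.
Qed.

Lemma unchoiK (R : realType) (p q : nat) (D : 'M[R[i]]_(p * q)) :
  choi (unchoi D) = D.
Proof.
apply: matrix_mxtensP => i a j b; rewrite choiE mxE (bigD1 i) //=.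
rewrite [X in _ + X]big1 => [|k /negPf ki]; last first.
  by rewrite big1 // => l _; rewrite mxE ki mul0r.
rewrite addr0 (bigD1 j) //= [X in _ + X]big1 => [|l /negPf lj].
  by rewrite addr0 mxE !eqxx mul1r.
by rewrite mxE lj andbF mul0r.
Qed.

(** * Duality for the cone of C-positive maps *)

Lemma tildefE (R : realType) (p q : nat) (f : 'M[R[i]]_p -> 'M[R[i]]_q) X :
  tildef f X = \tr (choi f *m X^T).
Proof.
(* Both sides are the sum over i, a, j, b of f(e_ij)_ab X_(ia),(jb): the transposes inside the
   blocks together with the pairing of block (i, j) with e_ij amount to the full transpose of X. *)
rewrite /mxtrace sum_mxtens /tildef; apply: eq_bigr => i _.
rewrite exchange_big /=; apply: eq_bigr => a _.
rewrite mxE sum_mxtens; apply: eq_bigr => j _.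
by rewrite mxE; apply: eq_bigr => b _; rewrite choiE !mxE.
Qed.

(** The form of A^T at v is the form of A at the entrywise conjugate of v. *)
Lemma psd_tr (R : realType) (p : nat) (A : 'M[R[i]]_p) : psd A -> psd A^T.
Proof.
move=> Apsd v; have := Apsd (adjmx v)^T.
have -> : adjmx (adjmx v)^T = v^T.
  by apply/matrixP=> i j; rewrite adjmxE !mxE conjcK.
have -> : v^T *m A *m (adjmx v)^T = (adjmx v *m A^T *m v)^T.
  by rewrite !trmx_mul (trmxK A) mulmxA.
by rewrite mxE.
Qed.

Lemma ampl_id (R : realType) (k p : nat) (X : 'M[R[i]]_(k * p)) :
  ampl k id X = X.
Proof.
by apply: matrix_mxtensP => i a j b; rewrite !mxE !mxtens_indexK.
Qed.

Lemma quad_trace (R : realType) (p : nat) (A : 'M[R[i]]_p) (v : 'cV[R[i]]_p) :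
  (adjmx v *m A *m v) 0 0 = \tr (A *m (v *m adjmx v)).
Proof. by rewrite mulmxA mxtrace_mulC mulmxA /mxtrace big_ord1. Qed.

(** For the converse, each X in [PBK] supplies its own test map: by [tildefE] the map with Choi
    matrix X^T lies in the dual cone, and pairing it with f gives back the value of the functional
    of f at X. *)
Lemma Cpositive_dualP (R : realType) (p q : nat)
    (Cc : set ('M[R[i]]_q -> 'M[R[i]]_q)) (f : 'M[R[i]]_p -> 'M[R[i]]_q) :
  linear f ->
  Cpositive Cc f <->
  (forall psi, PCdual p Cc psi -> 0 <= \tr (choi psi *m choi f)).
Proof.
move=> flin; split=> [fpos psi [_ ]|fdual X XP]; first by apply; split.
rewrite tildefE -[X^T]unchoiK mxtrace_mulC; apply: fdual.
split=> [|chi [_ chipos]]; first exact: unchoi_linear.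
by rewrite unchoiK mxtrace_mulC -tildefE; apply: chipos.
Qed.

(** The form of C_psi at v is its pairing with the rank one matrix v v^*. The map with that Choi
    matrix is C-positive, because taking alpha = [id] in [PBK] makes X, hence X^T, positive. *)
Lemma PCdual_psd (R : realType) (p q : nat)
    (Cc : set ('M[R[i]]_q -> 'M[R[i]]_q)) (psi : 'M[R[i]]_p -> 'M[R[i]]_q) :
  Cc id -> PCdual p Cc psi -> psd (choi psi).
Proof.
move=> Cid [_ psidual] v.
have := psidual (unchoi (v *m adjmx v)); rewrite unchoiK.
rewrite quad_trace; apply; split; first exact: unchoi_linear.
move=> X /(_ id Cid); rewrite ampl_id tildefE unchoiK => Xpsd.
have := psd_tr Xpsd v.
by rewrite quad_trace mxtrace_mulC.
Qed.

(** * Euclidean norm and operator norm *)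

Local Notation normc := ComplexField.Normc.normc.

(** Holds by conversion; it carries inequalities between real moduli to and from the order of
    [R[i]]. *)
Lemma normC_normc (R : realType) (z : R[i]) : (normc z)%:C%C = `|z|.
Proof. by []. Qed.

Lemma sqr_vnorm (R : realType) (p : nat) (v : 'cV[R[i]]_p) :
  vnorm v ^+ 2 = \sum_(i < p) normc (v i 0) ^+ 2.
Proof. by rewrite sqr_sqrtr // sumr_ge0 // => i _; rewrite sqr_ge0. Qed.

Lemma vnorm_adj (R : realType) (p : nat) (v : 'cV[R[i]]_p) :
  (adjmx v *m v) 0 0 = (vnorm v ^+ 2)%:C%C.
Proof.
rewrite sqr_vnorm mxE rmorph_sum; apply: eq_bigr => i _.
by rewrite rmorphXn /= normC_normc sqr_normc adjmxE mulrC.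
Qed.

Lemma normc_ge0 (R : realType) (z : R[i]) : 0 <= normc z.
Proof. by rewrite -ler0c normC_normc. Qed.

Lemma vnorm_ge0 (R : realType) (p : nat) (v : 'cV[R[i]]_p) : 0 <= vnorm v.
Proof. exact: sqrtr_ge0. Qed.

Lemma vnormZ (R : realType) (p : nat) (c : R[i]) (v : 'cV[R[i]]_p) :
  vnorm (c *: v) = normc c * vnorm v.
Proof.
rewrite -[normc c](@ger0_norm R) ?normc_ge0 // -sqrtr_sqr -sqrtrM ?sqr_ge0 //.
rewrite mulr_sumr; congr Num.sqrt; apply: eq_bigr => i _.
by rewrite mxE ComplexField.Normc.normcM exprMn.
Qed.

Lemma vnorm0 (R : realType) (p : nat) : vnorm (0 : 'cV[R[i]]_p) = 0.
Proof.
by rewrite -[X in vnorm X](scale0r 0) vnormZ ComplexField.Normc.normc0 mul0r.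
Qed.

Lemma vnorm_coord (R : realType) (p : nat) (v : 'cV[R[i]]_p) i :
  normc (v i 0) <= vnorm v.
Proof.
rewrite -(@ler_pXn2r R 2) ?nnegrE ?normc_ge0 ?vnorm_ge0 // sqr_vnorm.
by rewrite (bigD1 i) //= lerDl sumr_ge0 // => j _; rewrite sqr_ge0.
Qed.

Lemma vnorm_eq0 (R : realType) (p : nat) (v : 'cV[R[i]]_p) :
  vnorm v = 0 -> v = 0.
Proof.
move=> v0; apply/colP => i; rewrite mxE.
apply: ComplexField.Normc.eq0_normc; apply: le_anti.
by rewrite normc_ge0 -v0 vnorm_coord.
Qed.

(** A crude bound suffices: every coordinate of v has modulus at most 1, so row i of A v is bounded
    by the sum of the moduli of row i of A. Finiteness is what makes [sup] an actual upper bound. *)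
Lemma opnorm_has_ubound (R : realType) (p : nat) (A : 'M[R[i]]_p) :
  has_ubound [set r : R | exists v : 'cV[R[i]]_p,
    vnorm v <= 1 /\ r = vnorm (A *m v)].
Proof.
exists (Num.sqrt (\sum_i (\sum_j normc (A i j)) ^+ 2)) => _ [v [v1 ->]].
rewrite ler_sqrt; last by rewrite sumr_ge0 // => i _; rewrite sqr_ge0.
apply: ler_sum => i _.
rewrite ler_pXn2r ?nnegrE ?normc_ge0 //; last first.
  by rewrite sumr_ge0 // => j _; rewrite normc_ge0.
rewrite -lecR normC_normc rmorph_sum mxE; apply: le_trans (ler_norm_sum _ _ _) _.
apply: ler_sum => j _; rewrite normrM -!normC_normc -rmorphM lecR.
by rewrite ler_piMr ?normc_ge0 // (le_trans (vnorm_coord _ _)).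
Qed.

Lemma opnorm_ge0 (R : realType) (p : nat) (A : 'M[R[i]]_p) : 0 <= opnorm A.
Proof.
apply: ub_le_sup; first exact: opnorm_has_ubound.
by exists 0; rewrite mulmx0 vnorm0 ler01.
Qed.

Lemma vnorm_mulmx (R : realType) (p : nat) (A : 'M[R[i]]_p) (v : 'cV[R[i]]_p) :
  vnorm (A *m v) <= opnorm A * vnorm v.
Proof.
have [/vnorm_eq0 ->|v0] := eqVneq (vnorm v) 0.
  by rewrite mulmx0 vnorm0 mulr0.
have vgt0 : 0 < vnorm v by rewrite lt_neqAle eq_sym v0 vnorm_ge0.
have nE : normc ((vnorm v)^-1)%:C%C = (vnorm v)^-1.
  by apply: complexI; rewrite normC_normc ger0_norm // ler0c invr_ge0 vnorm_ge0.
rewrite -ler_pdivrMr // mulrC -nE -vnormZ.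
apply: ub_le_sup; first exact: opnorm_has_ubound.
exists (((vnorm v)^-1)%:C%C *: v).
by rewrite vnormZ nE mulVf // scalemxAr.
Qed.

Lemma opnorm_eq0 (R : realType) (p : nat) (A : 'M[R[i]]_p) :
  opnorm A = 0 -> A = 0.
Proof.
move=> A0; apply/matrixP=> i j.
have /(congr1 (fun B : 'cV_p => B i 0)) : A *m (delta_mx j 0 : 'cV_p) = 0.
  apply: vnorm_eq0; apply: le_anti; rewrite vnorm_ge0 andbT.
  by rewrite (le_trans (vnorm_mulmx _ _)) // A0 mul0r.
by rewrite -colE !mxE.
Qed.

Lemma psd_opnorm (R : realType) (p : nat) (A : 'M[R[i]]_p) :
  psd A -> psd ((opnorm A)%:C%C *: 1%:M - A).
Proof.
move=> Apsd v; set N := opnorm A.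
(* The general argument ends by cancelling the factor 2N, so N = 0 is settled first; there A = 0. *)
have [N0|Nn0] := eqVneq N 0.
  rewrite (opnorm_eq0 N0) N0 scale0r subr0 mulmx0 mul0mx mxE //.
have Ngt0 : 0 < N by rewrite lt_neqAle eq_sym Nn0 opnorm_ge0.
have addE (X Y : 'M[R[i]]_1) : (X + Y) 0 0 = X 0 0 + Y 0 0 by rewrite mxE.
have oppE (X : 'M[R[i]]_1) : (- X) 0 0 = - X 0 0 by rewrite mxE.
have scaleE (c : R[i]) (X : 'M[R[i]]_1) : (c *: X) 0 0 = c * X 0 0.
  by rewrite mxE.
set q := (adjmx v *m A *m v) 0 0.
have qE : (adjmx v *m (N%:C%C *: 1%:M - A) *m v) 0 0 =
          N%:C%C * (vnorm v ^+ 2)%:C%C - q.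
  rewrite mulmxBr mulmxBl addE oppE -scalemxAr -scalemxAl scaleE mulmx1.
  by rewrite vnorm_adj.
(* Expanding [|Av - Nv|^2 >= 0] and using [|Av| <= N|v|] avoids Cauchy-Schwarz. *)
have : 0 <= (adjmx (A *m v - N%:C%C *: v) *m (A *m v - N%:C%C *: v)) 0 0.
  by rewrite vnorm_adj ler0c sqr_ge0.
have -> : (adjmx (A *m v - N%:C%C *: v) *m (A *m v - N%:C%C *: v)) 0 0 =
    (vnorm (A *m v) ^+ 2)%:C%C - N%:C%C * q *+ 2
    + N%:C%C * (N%:C%C * (vnorm v ^+ 2)%:C%C).
  rewrite adjmxD adjmxN adjmxZ conjc_real !(mulmxBl, mulmxBr) !(addE, oppE).
  rewrite -!scalemxAl -!scalemxAr !scaleE !vnorm_adj.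
  have -> : (adjmx (A *m v) *m v) 0 0 = q by rewrite adjmxM psd_hermitian.
  have -> : (adjmx v *m (A *m v)) 0 0 = q by rewrite mulmxA.
  by ring.
have : (vnorm (A *m v) ^+ 2)%:C%C <= N%:C%C * (N%:C%C * (vnorm v ^+ 2)%:C%C).
  rewrite -!rmorphM lecR mulrA -expr2 -exprMn.
  by rewrite ler_pXn2r ?nnegrE ?mulr_ge0 ?vnorm_ge0 ?opnorm_ge0 ?vnorm_mulmx.
rewrite qE => h1 h2.
(* Adding the two inequalities gives 0 <= 2N (N |v|^2 - q), and 2N > 0 is cancelled. *)
have N2 : 0 < N%:C%C *+ 2 :> R[i] by rewrite pmulrn_lgt0 // ltcR.
rewrite -(pmulr_rge0 _ N2).
have := addr_ge0 h2; rewrite -subr_ge0 in h1 => /(_ _ h1).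
by congr (0 <= _); ring.
Qed.

(** * Choi matrices of the trace map and of linear combinations *)

Lemma choi_trmap (R : realType) (p q : nat) :
  choi (@trmap R p q) = 1%:M.
Proof.
apply: matrix_mxtensP => i a j b; rewrite choiE /trmap !mxE.
rewrite (can_eq (@mxtens_indexK p q)) xpair_eqE -mulnb natrM; congr (_ * _).
rewrite /mxtrace (bigD1 i) //= big1 => [|k /negPf ki].
  by rewrite addr0 mxE eqxx.
by rewrite mxE ki.
Qed.

Lemma choi_lincomb (R : realType) (p q : nat) (c : R[i])
    (f g : 'M[R[i]]_p -> 'M[R[i]]_q) :
  choi (fun x => f x - c *: g x) = choi f - c *: choi g.
Proof.
apply: matrix_mxtensP => i a j b.
by rewrite !(choiE, mxE).
Qed.

Lemma choiZ (R : realType) (p q : nat) (c : R[i])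
    (f : 'M[R[i]]_p -> 'M[R[i]]_q) :
  choi (fun x => c *: f x) = c *: choi f.
Proof. by apply: matrix_mxtensP => i a j b; rewrite !(choiE, mxE). Qed.

Lemma PCdualZ (R : realType) (p q : nat)
    (Cc : set ('M[R[i]]_q -> 'M[R[i]]_q)) (c : R[i])
    (psi : 'M[R[i]]_p -> 'M[R[i]]_q) :
  0 <= c -> PCdual p Cc psi -> PCdual p Cc (fun x => c *: psi x).
Proof.
move=> c0 [psilin psidual]; split=> [d x y|chi chiP].
  by rewrite psilin scalerDr !scalerA mulrC.
by rewrite choiZ -scalemxAl mxtraceZ mulr_ge0 // psidual.
Qed.

Lemma cpmap_id (R : realType) (p : nat) : cpmap (@id 'M[R[i]]_p).
Proof. by split=> // k X Xpsd; rewrite ampl_id. Qed.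

(** * The norm attached to the cone *)

Lemma mxtrace_psd_ge0 (R : realType) (p : nat) (A : 'M[R[i]]_p) :
  psd A -> 0 <= \tr A.
Proof.
by move=> Apsd; rewrite sumr_ge0 // => i _; have := Apsd (delta_mx i 0);
  rewrite sesq_delta.
Qed.

Lemma mxtrace_psd_bound (R : realType) (p : nat) (D B : 'M[R[i]]_p) :
  psd D -> psd B -> \tr (D *m B) <= (opnorm B)%:C%C * \tr D.
Proof.
move=> Dpsd Bpsd; have := mxtrace_psdM_ge0 Dpsd (psd_opnorm Bpsd).
by rewrite mulmxBr -scalemxAr mulmx1 linearB /= linearZ /= subr_ge0.
Qed.

Lemma Cnorm_le1P (R : realType) (p q : nat)
    (Cc : set ('M[R[i]]_q -> 'M[R[i]]_q)) (f : 'M[R[i]]_p -> 'M[R[i]]_q) :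
  Cc id -> psd (choi f) ->
  Cnorm Cc f <= 1 <->
  (forall psi, PCdual p Cc psi -> \tr (choi f *m choi psi) <= \tr (choi psi)).
Proof.
move=> Cid fpsd.
have tr_ge0 psi : PCdual p Cc psi -> 0 <= \tr (choi f *m choi psi).
  by move=> /(PCdual_psd Cid); apply: mxtrace_psdM_ge0.
have normc_tr psi : PCdual p Cc psi ->
    (normc (\tr (choi f *m choi psi)))%:C%C = \tr (choi f *m choi psi).
  by move=> psiP; rewrite normC_normc ger0_norm // tr_ge0.
have tr_bound psi : PCdual p Cc psi ->
    \tr (choi f *m choi psi) <= (opnorm (choi f))%:C%C * \tr (choi psi).
  move=> psiP; rewrite mxtrace_mulC.
  exact: mxtrace_psd_bound (PCdual_psd Cid psiP) fpsd.
split=> [Cle psi psiP|fle]; last first.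
  rewrite /Cnorm; set S := (X in sup X).
  (* If no dual map has trace one, [sup] takes its default value 0, which is at most 1. *)
  have [->|/set0P S0] := eqVneq S set0; first by rewrite sup0 ler01.
  apply: ge_sup => // _ [psi [psiP [psi1 ->]]].
  by rewrite -lecR normc_tr // -[1%:C%C]psi1 fle.
have T_ge0 : 0 <= \tr (choi psi).
  exact: mxtrace_psd_ge0 (PCdual_psd Cid psiP).
(* A trace of 0 cannot be normalized; the operator norm bound then gives the inequality directly. *)
have [T0|Tn0] := eqVneq (\tr (choi psi)) 0.
  by rewrite T0; have := tr_bound _ psiP; rewrite T0 mulr0.
have Tgt0 : 0 < \tr (choi psi) by rewrite lt_def Tn0.
pose psi1 := fun x => (\tr (choi psi))^-1 *: psi x.
have psi1P : PCdual p Cc psi1 by apply: PCdualZ psiP; rewrite invr_ge0.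
suff : \tr (choi f *m choi psi1) <= 1.
  by rewrite choiZ -scalemxAr mxtraceZ mulrC ler_pdivrMr // mul1r.
rewrite -normc_tr // -[1]/(1%:C%C) lecR (le_trans _ Cle) //.
apply: ub_le_sup; last first.
  by exists psi1; rewrite choiZ mxtraceZ mulVf.
(* Boundedness of the set, required by [ub_le_sup]: at trace one [tr_bound] reduces to the operator
   norm of C_f. *)
exists (opnorm (choi f)) => _ [chi [chiP [chi1 ->]]].
by rewrite -lecR normc_tr // (le_trans (tr_bound _ chiP)) // chi1 mulr1.
Qed.

(** The two suprema run over the same set: a dual map psi of trace one corresponds to the state x ->
    Tr(C_psi x), and positivity of C_f makes its value there equal to its modulus. *)
Lemma Cnorm_states (R : realType) (m n : nat)
    (Cc : set ('M[R[i]]_n -> 'M[R[i]]_n)) (f : 'M[R[i]]_m -> 'M[R[i]]_n) :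
  Cc id -> psd (choi f) ->
  Cnorm Cc f =
    sup [set r : R | exists (rho : 'M[R[i]]_(m * n) -> R[i])
                            (psi : 'M[R[i]]_m -> 'M[R[i]]_n),
           [/\ state rho, PCdual m Cc psi, has_density rho (choi psi)
             & rho (choi f) = (r%:C)%C]].
Proof.
move=> Cid fpsd; congr sup; apply/seteqP; split=> r.
  move=> [psi [psiP [psi1 ->]]]; have psipsd := PCdual_psd Cid psiP.
  exists (fun x => \tr (choi psi *m x)), psi; split=> //.
    split=> [c x y|A Apsd|]; last by rewrite mulmx1.
      by rewrite mulmxDr -scalemxAr linearD /= linearZ.
    exact: mxtrace_psdM_ge0.
  by rewrite normC_normc mxtrace_mulC ger0_norm // mxtrace_psdM_ge0.
move=> [rho [psi [[_ rho_ge0 rho1] psiP rhoE rE]]].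
exists psi; split=> //; split; first by rewrite -rho1 rhoE mulmx1.
apply: complexI; rewrite normC_normc mxtrace_mulC -rhoE ger0_norm //.
exact: rho_ge0.
Qed.

Theorem theorem1 (R : realType) (m n : nat)
  (phi : 'M[R[i]]_m -> 'M[R[i]]_n) :
  linear phi -> selfadjoint_map phi -> ~ cpmap (fun x => - phi x) ->
  forall Cp Cm : 'M[R[i]]_(m * n),
    psd Cp -> psd Cm -> orth_supports Cp Cm -> choi phi = Cp - Cm ->
  exists phicp : 'M[R[i]]_m -> 'M[R[i]]_n,
    [/\ cpmap phicp,
        (forall x, ((opnorm Cp)^-1)%:C%C *: phi x = trmap x - phicp x) &
        (forall Cc : set ('M[R[i]]_n -> 'M[R[i]]_n),
           mapping_cone Cc -> (forall f, cpmap f -> Cc f) ->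
           Cnorm Cc phicp =
             sup [set r : R | exists (rho : 'M[R[i]]_(m * n) -> R[i])
                                     (psi : 'M[R[i]]_m -> 'M[R[i]]_n),
                    [/\ state rho, PCdual m Cc psi, has_density rho (choi psi)
                      & rho (choi phicp) = (r%:C)%C]]
           /\ (Cpositive Cc phi <-> Cnorm Cc phicp <= 1))].
Proof.
move=> phi_lin _ nphi_ncp Cp Cm Cp_psd Cm_psd _ choi_phi.
(* If the norm were 0, then C_phi = - Cm, so - phi would have the positive Choi matrix Cm and be
   completely positive. *)
have N_gt0 : 0 < opnorm Cp.
  rewrite lt_neqAle opnorm_ge0 andbT eq_sym.
  apply/eqP => /opnorm_eq0 Cp0; apply: nphi_ncp; apply: choi_psd_cp.
    by move=> c x y; rewrite phi_lin opprD scalerN.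
  suff -> : choi (fun x => - phi x) = Cm by [].
  rewrite -[Cm]opprK -[- Cm]add0r -[X in X - Cm]Cp0 -choi_phi.
  by apply: matrix_mxtensP => i a j b; rewrite !(choiE, mxE).
pose c : R[i] := ((opnorm Cp)^-1)%:C%C.
have c_gt0 : 0 < c by rewrite ltcR invr_gt0.
(* The identity in (i) leaves no other choice. *)
pose phicp x := trmap x - c *: phi x.
have choi_phicp : choi phicp = 1%:M - c *: choi phi.
  by rewrite choi_lincomb choi_trmap.
have phicp_lin : linear phicp.
  move=> d x y; rewrite /phicp /trmap phi_lin linearD /= linearZ /=.
  by apply/matrixP=> a b; rewrite !mxE; ring.
have phicp_psd : psd (choi phicp).
  suff -> : choi phicp = c *: ((opnorm Cp)%:C%C *: 1%:M - Cp) + c *: Cm.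
    by apply: psdD; apply: psdZ; rewrite ?(ltW c_gt0) //; apply: psd_opnorm.
  rewrite choi_phicp choi_phi !scalerBr scalerA -rmorphM mulVf ?gt_eqF //.
  by rewrite scale1r opprB addrA addrAC.
exists phicp; split=> [|x|Cc _ cp_Cc]; first exact: choi_psd_cp.
  by rewrite /phicp opprB addrC subrK.
have Cid : Cc id by apply: cp_Cc; apply: cpmap_id.
split; first exact: Cnorm_states.
(* Since C_phicp = 1 - c C_phi, the right side minus the left side of the second inequality is c
   Tr(C_phi C_psi), and c > 0. *)
have key psi : (0 <= \tr (choi psi *m choi phi)) =
    (\tr (choi phicp *m choi psi) <= \tr (choi psi)).
  rewrite choi_phicp mulmxBl mul1mx -scalemxAl linearB /= linearZ /=.
  by rewrite gerBl pmulr_rge0 // mxtrace_mulC.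
split=> [phiP|].
  apply/Cnorm_le1P => // psi psiP; rewrite -key.
  by move/Cpositive_dualP: phiP => /(_ phi_lin); apply.
move/Cnorm_le1P => le1; apply/Cpositive_dualP => // psi psiP.
by rewrite key; apply: le1.
Qed.
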